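(* Let $G$ be a finite simple graph of order $n$ without isolated vertices, with largest vertex degree $\Delta$ and smallest vertex degree $\delta$. If $\Delta-\delta\ge 2$, then $$s_Q(G)\ \ge\ \left((\Delta-\delta)^2+2\Delta+2\delta\right)^{1/2},$$ and otherwise (when $\Delta-\delta\le 1$) $$s_Q(G)\ \ge\ 2\sqrt{\Delta}.$$ Equality holds for $G\simeq K_2$.
   Context: For a finite simple graph $G$ on $n$ vertices, let $A_G$ be its adjacency matrix and $D_G$ the diagonal matrix of vertex degrees. The signless Laplacian matrix is $Q_G=D_G+A_G$ with eigenvalues $q_1\ge q_2\ge\cdots\ge q_n$, and the signless Laplacian spread is $s_Q(G)=q_1-q_n$. $K_2$ is the complete graph on two vertices. *)

(* Defs.v *)
From HB Require Import structures.
From mathcomp Require Import all_boot all_order all_algebra.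
From mathcomp Require Import polyrcf complex spectral.

Set Implicit Arguments.
Unset Strict Implicit.
Unset Printing Implicit Defensive.

Import Order.TTheory GRing.Theory Num.Theory.
Local Open Scope ring_scope.

Record sgraph := SGraph {
  vertex :> finType;
  adj : rel vertex;
  adj_sym : symmetric adj;
  adj_irrefl : irreflexive adj
}.

Section Graph.
Variable G : sgraph.

Definition degree (v : G) : nat := #|[set w | adj v w]|.

Definition maxdeg : nat := \max_(v : G) degree v.

(* Every degree is less than #|G|, so for a nonempty graph the default value
   #|G| of the iterated minimum is never attained. *)
Definition mindeg : nat := \big[minn/#|G|]_(v : G) degree v.

Definition no_isolated : Prop := forall v : G, (0 < degree v)%N.

(* Matrices indexed by the vertices, enumerated by enum_val. *)
Definition adjacency_mx (R : pzRingType) : 'M[R]_#|G| :=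
  \matrix_(i, j) (adj (enum_val i) (enum_val j))%:R.

Definition degree_mx (R : pzRingType) : 'M[R]_#|G| :=
  diag_mx (\row_i (degree (enum_val i))%:R).

Definition signless_laplacian (R : pzRingType) : 'M[R]_#|G| :=
  degree_mx R + adjacency_mx R.

End Graph.

Definition graph_iso (G H : sgraph) : Prop :=
  exists2 f : G -> H, bijective f & forall x y, adj (f x) (f y) = adj x y.

Lemma complete_adj_sym (n : nat) : symmetric (fun i j : 'I_n => i != j).
Proof. by move=> i j; rewrite eq_sym. Qed.

Lemma complete_adj_irrefl (n : nat) : irreflexive (fun i j : 'I_n => i != j).
Proof. by move=> i; rewrite eqxx. Qed.

Definition complete_graph (n : nat) : sgraph :=
  SGraph (@complete_adj_sym n) (@complete_adj_irrefl n).

(* The roots in R of the characteristic polynomial, in nonincreasing order and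
   repeated according to their multiplicities. *)
Definition eigenvals (R : rcfType) (n : nat) (A : 'M[R]_n) : seq R :=
  flatten [seq nseq (mup x (char_poly A)) x | x <- rev (rootsR (char_poly A))].

Lemma sym_char_poly_split (R : rcfType) (n : nat) (A : 'M[R]_n) :
  A^T = A -> exists s : seq R, char_poly A = \prod_(x <- s) ('X - x%:P).
Proof.
move=> symA; pose c : {rmorphism R -> R[i]} := real_complex R.
have real_c x : c x \is Num.real by apply/complex_realP; exists x.
have hermA : map_mx c A \is hermsymmx.
  apply: realsym_hermsym.
    by apply/is_hermitianmxP; rewrite expr0 scale1r map_mx_id // map_trmx symA.
  by apply/mxOverP => i j; rewrite mxE.
set B := map_mx c A in hermA.
have /mxOverP Dr := hermitian_spectral_diag_real hermA.
have /hermitian_normalmx/orthomx_spectralP := hermA.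
have := spectral_unit B; set P := spectralmx B; set D := spectral_diag B => uP eB.
exists [seq complex.Re (D 0 i) | i : 'I_n].
apply: (map_poly_inj c); rewrite map_char_poly -/B big_map big_enum rmorph_prod.
have -> : char_poly B = char_poly (diag_mx D).
  have e : map_mx polyC P *m char_poly_mx B = char_poly_mx (diag_mx D) *m map_mx polyC P.
    rewrite /char_poly_mx mulmxBr mulmxBl scalar_mxC -!map_mxM; congr (_ - map_mx _ _).
    by rewrite eB -mulmxA mulKVmx.
  apply: (@mulfI _ (\det (map_mx polyC P))).
    by rewrite det_map_mx polyC_eq0 -unitfE -unitmxE.
  by rewrite /char_poly -det_mulmx e det_mulmx mulrC.
rewrite char_poly_trig ?diag_mx_is_trig //; apply: eq_bigr => i _.
rewrite /= map_polyXsubC mxE eqxx mulr1n -[c _]/(_%:C)%C RRe_real //.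
Qed.

Lemma eigenvals_split (R : rcfType) (n : nat) (A : 'M[R]_n) : A^T = A ->
  char_poly A = \prod_(x <- eigenvals A) ('X - x%:P).
Proof.
move=> /sym_char_poly_split[s es].
have p0 : char_poly A != 0 by rewrite monic_neq0 ?char_poly_monic.
suff ps : perm_eq (eigenvals A) s by rewrite (perm_big _ ps).
apply/allP => x _ /=; apply/eqP.
rewrite /eigenvals count_flatten -map_comp map_rev sumn_rev.
rewrite (eq_map (g := fun y => (y == x) * mup y (char_poly A))%N); last first.
  by move=> y /=; rewrite count_nseq.
rewrite sumnE big_map.
have := roots_on_rootsR p0; move/(_ x); rewrite inE /= => rx.
have [rxp|nrx] := boolP (x \in rootsR (char_poly A)).
  rewrite (bigD1_seq x) ?uniq_roots //= eqxx mul1n big1 ?addn0 => [|y /negPf->] //.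
  by rewrite es mu_prod_XsubC.
rewrite big_seq big1 => [|y yin].
  have : ~~ root (char_poly A) x by rewrite rx.
  by rewrite es => /mupNroot; rewrite mu_prod_XsubC.
by case: eqP yin nrx => // -> ->.
Qed.

Lemma size_eigenvals (R : rcfType) (n : nat) (A : 'M[R]_n) : A^T = A ->
  size (eigenvals A) = n.
Proof.
move=> /eigenvals_split/(congr1 (fun p : {poly R} => size p)).
by rewrite size_char_poly size_prod_XsubC => -[].
Qed.

Lemma eigenvals_sorted (R : rcfType) (n : nat) (A : 'M[R]_n) :
  sorted >=%O (eigenvals A).
Proof.
have : sorted >%O (rev (rootsR (char_poly A))).
  by rewrite rev_sorted; apply: sorted_roots.
rewrite /eigenvals; move: (rev _) => r.
rewrite (sorted_pairwise (rev_trans lt_trans)) (sorted_pairwise (rev_trans le_trans)).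
elim: r => //= x r IH /andP[/allP xr /IH pr].
rewrite pairwise_cat pr andbT; apply/andP; split.
  apply/allrelP => y z /nseqP[-> _] /flattenP[l /mapP[w wr ->]] /nseqP[-> _].
  by apply/ltW/xr.
by elim: mup => //= m ->; rewrite andbT; apply/allP => y /nseqP[->].
Qed.

Lemma signless_laplacian_sym (R : pzRingType) (G : sgraph) :
  (signless_laplacian G R)^T = signless_laplacian G R.
Proof.
rewrite /signless_laplacian linearD /= tr_diag_mx; congr (_ + _).
by apply/matrixP => i j; rewrite !mxE adj_sym.
Qed.

(* q_i is entry i - 1 of the list; the list has #|G| entries by
   [size_eigenvals], so the default value 0 of nth plays no role unless G is
   empty. *)
Definition spread_Q (R : rcfType) (G : sgraph) : R :=
  let q := eigenvals (signless_laplacian G R) in q`_0 - q`_(#|G|.-1).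

(* Main.v *)
(* If [m] and [M] are the extreme eigenvalues of a symmetric matrix [A], then
   (A - M)(A - m) is negative semidefinite; its diagonal entries bound the norm
   of row i of A - c by (M - m) / 2, where c = (M + m) / 2.  For the signless
   Laplacian and a vertex of degree d this reads
     (d - c)^2 + d <= (s_Q / 2)^2.
   A vertex of degree [Delta] gives the bound 2 sqrt [Delta]; adding the
   inequalities for [Delta] and [delta] gives the other bound, because
   2 (Delta - c)^2 + 2 (delta - c)^2 >= (Delta - delta)^2. *)
Require Import Defs.
From mathcomp Require Import all_boot all_order all_algebra.
From mathcomp Require Import polyrcf complex spectral.
From mathcomp Require Import ring lra.

Import Order.TTheory GRing.Theory Num.Theory.
Local Open Scope ring_scope.

(** Scalar matrices commute with [P], so both factors are diagonalized by the same basis. *)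
Lemma conj_diag_mx_quadratic {R : comUnitRingType} {n : nat} {P : 'M[R]_n}
    {D : 'rV[R]_n} (a b : R) : P \in unitmx ->
  (invmx P *m diag_mx D *m P - a%:M) *m (invmx P *m diag_mx D *m P - b%:M)
  = invmx P *m diag_mx (\row_k ((D 0 k - a) * (D 0 k - b))) *m P.
Proof.
move=> uP.
have shift x : invmx P *m diag_mx D *m P - x%:M
    = invmx P *m diag_mx (\row_k (D 0 k - x)) *m P.
  have -> : diag_mx (\row_k (D 0 k - x)) = diag_mx D - x%:M.
    by apply/matrixP => k l; rewrite !mxE -mulrnBl; case: eqP => [->|].
  rewrite mulmxBr mulmxBl; congr (_ - _).
  by rewrite scalar_mxC -mulmxA mulVmx // mulmx1.
rewrite !shift !mulmxA mulmxK //; congr (_ *m _); rewrite -!mulmxA mulmx_diag.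
by congr (_ *m diag_mx _); apply/rowP => k; rewrite !mxE.
Qed.

(** The spectral theorem is applied over [R[i]], to the image [B] of [A]; since [A] is symmetric,
    the left-hand side is the diagonal entry of [A *m A] at [i]. *)
Lemma sym_row_sqr_le {R : rcfType} {n : nat} {A : 'M[R]_n} {m M : R} (i : 'I_n) :
  A^T = A -> (forall x, root (char_poly A) x -> m <= x <= M) ->
  \sum_j A i j ^+ 2 <= (M + m) * A i i - M * m.
Proof.
move=> symA rootA; pose c : {rmorphism R -> R[i]} := real_complex R.
have hermA : map_mx c A \is hermsymmx.
  apply: realsym_hermsym.
    by apply/is_hermitianmxP; rewrite expr0 scale1r map_mx_id // map_trmx symA.
  by apply/mxOverP => k l; rewrite mxE; apply/complex_realP; exists (A k l).
set B := map_mx c A in hermA.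
have /mxOverP Dr := hermitian_spectral_diag_real hermA.
have /hermitian_normalmx/orthomx_spectralP := hermA.
have := spectral_unitarymx B.
move: (spectralmx B) (spectral_diag B) Dr => P D Dr unitaryP eB.
have uP := unitarymx_unit unitaryP.
(* Row [k] of [P] is a left eigenvector for [D 0 k], nonzero because [P] is invertible; this
   eigenvalue is real, hence comes from a root in [R]. *)
have bndD k : c m <= D 0 k <= c M.
  have rD : root (char_poly B) (D 0 k).
    rewrite -eigenvalue_root_char; apply/eigenvalueP; exists (row k P).
      rewrite eB -row_mul !mulmxA mulmxV // mul1mx row_mul.
      by rewrite row_diag_mx -scalemxAl -rowE.
    apply/negP => /eqP P0; have := row_free_unit P; rewrite uP => /row_freeP[Q PQ].
    have /matrixP/(_ 0 k) := congr1 (fun v => v *m Q) P0.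
    by rewrite -row_mul PQ mul0mx !mxE eqxx => /eqP; rewrite oner_eq0.
  have /complex_realP[d eD] := Dr 0 k.
  move: rD; rewrite eD -map_char_poly fmorph_root => /rootA.
  by rewrite !lecR.
have eBMm : (B - (c M)%:M) *m (B - (c m)%:M)
    = invmx P *m diag_mx (\row_k ((D 0 k - c M) * (D 0 k - c m))) *m P.
  by rewrite [in LHS]eB; apply: conj_diag_mx_quadratic.
have : ((B - (c M)%:M) *m (B - (c m)%:M)) i i <= 0.
  (* As [P] is unitary, the entry is the sum over [k] of [|P k i|^2 (D 0 k - M) (D 0 k - m)]. *)
  rewrite eBMm invmx_unitary // mxE; apply: sumr_le0 => k _.
  rewrite mul_mx_diag !mxE mulrAC mulrC -normCKC.
  apply: mulr_le0_ge0; last by rewrite exprn_ge0.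
  have /andP[mD DM] := bndD k.
  by rewrite mulr_le0_ge0 ?subr_le0 ?subr_ge0.
have -> : ((B - (c M)%:M) *m (B - (c m)%:M)) i i
    = c (\sum_j A i j ^+ 2 - (M + m) * A i i + M * m).
  have -> : (B - (c M)%:M) *m (B - (c m)%:M)
     = map_mx c ((A - M%:M) *m (A - m%:M)).
    by rewrite map_mxM !map_mxB !map_scalar_mx.
  rewrite mxE; congr (c _).
  rewrite mulmxBr !mulmxBl mul_mx_scalar mul_scalar_mx -scalar_mxM !mxE eqxx.
  have -> : \sum_j A i j * A j i = \sum_j A i j ^+ 2.
    by apply: eq_bigr => j _; rewrite -{2}symA mxE.
  by rewrite mulr1n; ring.
by rewrite lecR; lra.
Qed.

(** Symmetry gives the list [n] entries, so both indices are in range. *)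
Lemma le_eigenvals {R : rcfType} {n : nat} {A : 'M[R]_n} {i j : nat} :
  A^T = A -> (i <= j < n)%N -> (eigenvals A)`_j <= (eigenvals A)`_i.
Proof.
move=> symA /andP[ij jn].
apply: (sorted_leq_nth (rev_trans le_trans) le_refl 0 (eigenvals_sorted A)) => //.
  by rewrite inE size_eigenvals // (leq_ltn_trans ij jn).
by rewrite inE size_eigenvals.
Qed.

Lemma root_char_poly_bounds {R : rcfType} {n : nat} {A : 'M[R]_n} (x : R) :
  A^T = A -> root (char_poly A) x ->
  (eigenvals A)`_n.-1 <= x <= (eigenvals A)`_0.
Proof.
move=> symA; rewrite (eigenvals_split symA) root_prod_XsubC => /(nthP 0)[k].
rewrite size_eigenvals // => kn <-.
have n0 : (0 < n)%N by apply: leq_ltn_trans kn.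
by rewrite !le_eigenvals //= ltn_predL n0 andbT -ltnS prednK.
Qed.

(** The diagonal contributes the squared degree; the other entries are 0 or 1, hence equal to their
    squares, and sum to the degree. *)
Lemma signless_laplacian_row_sqr {R : comPzRingType} {G : sgraph} (i : 'I_#|G|) :
  \sum_j signless_laplacian G R i j ^+ 2
  = (degree (enum_val i))%:R ^+ 2 + (degree (enum_val i))%:R.
Proof.
have -> : \sum_j signless_laplacian G R i j ^+ 2
    = \sum_j ((if j == i then (degree (enum_val i))%:R ^+ 2 else 0)
              + (adj (enum_val i) (enum_val j))%:R).
  apply: eq_bigr => j _; rewrite !mxE eq_sym; case: eqP => [->|_].
    by rewrite adj_irrefl !addr0.
  by rewrite mulr0n !add0r; case: adj; rewrite ?expr1n ?expr0n.
rewrite big_split /= -big_mkcond big_pred1_eq; congr (_ + _).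
rewrite -natr_sum; congr (_%:R).
rewrite /degree cardsE -[RHS]sum1_card [RHS]big_mkcond /=.
rewrite (reindex _ (onW_bij _ (enum_val_bij G))) /=.
by apply: eq_bigr => j _; rewrite -topredE /=; case: adj.
Qed.

Lemma signless_laplacian_diag {R : pzRingType} {G : sgraph} (i : 'I_#|G|) :
  signless_laplacian G R i i = (degree (enum_val i))%:R.
Proof. by rewrite !mxE eqxx adj_irrefl addr0. Qed.

Lemma spread_Q_ge0 {R : rcfType} {G : sgraph} : (0 < #|G|)%N -> 0 <= spread_Q R G.
Proof.
by move=> G0; rewrite subr_ge0 le_eigenvals ?signless_laplacian_sym ?ltn_predL.
Qed.

(* The midpoint [c] of the extreme eigenvalues is the same for all vertices,
   so these inequalities can be added up. *)
Lemma spread_Q_degree (R : rcfType) (G : sgraph) :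
  {c : R | forall v : G,
    ((degree v)%:R - c) ^+ 2 + (degree v)%:R <= (spread_Q R G / 2) ^+ 2}.
Proof.
pose Q := signless_laplacian G R; have symQ : Q^T = Q := signless_laplacian_sym R G.
exists (((eigenvals Q)`_0 + (eigenvals Q)`_#|G|.-1) / 2) => v.
have := sym_row_sqr_le (enum_rank v) symQ
  (fun x => root_char_poly_bounds x symQ).
rewrite signless_laplacian_row_sqr signless_laplacian_diag enum_rankK /spread_Q -/Q.
(* Completing the square, with [c ^+ 2 - a * b = ((a - b) / 2) ^+ 2] for the midpoint [c]. *)
by set a := _`_0; set b := _`__; set d := _%:R => ?; lra.
Qed.

Lemma maxdeg_attained {G : sgraph} : (0 < #|G|)%N -> {v : G | degree v = maxdeg G}.
Proof. by case/(bigop.eq_bigmax (@degree G)) => v dv; exists v. Qed.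

Lemma mindeg_attained {G : sgraph} : (0 < #|G|)%N -> {v : G | degree v = mindeg G}.
Proof.
case/card_gt0P/sigW => v0 _.
have [v _ ->] : {v : G | v \in predT & mindeg G = degree v}.
  by apply: (eq_bigmin v0) => // v _; apply: max_card.
by exists v.
Qed.

(** This is the signless Laplacian of [K_2]. The size is a variable [n] so that [#|G|] can be
    substituted for it. *)
Lemma eigenvals_ones_mx2 {R : rcfType} {n : nat} : n = 2 ->
  let q := eigenvals (const_mx 1 : 'M[R]_n) in q`_0 - q`_n.-1 = 2.
Proof.
move=> -> /=; set A : 'M[R]_2 := const_mx 1.
have symA : A^T = A by apply/matrixP => i j; rewrite !mxE.
have := le_eigenvals symA (isT : 0 <= 1 < 2)%N.
have := char_poly_det A; have := char_poly_trace A isT.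
rewrite (eigenvals_split symA).
have := size_eigenvals symA; case: (eigenvals A) => [|a [|b []]] //= _.
rewrite big_cons big_seq1 /= (expand_det_row _ 0) /mxtrace !big_ord_recl !big_ord0.
rewrite /cofactor !det_mx11 !mxE /=.
rewrite mulrBl !mulrBr -polyCM !coefE /=.
rewrite /bump /= !expr0 expr1 sqrrN expr1n => trA detA ba.
have ab : a + b = 2 by lra.
have ab0 : a * b = 0 by lra.
(* Trace and determinant give [(a - b) ^+ 2 = 4]; the positive factor [a - b + 2] excludes the root
   [-2]. *)
have pos : 0 < a - b + 2 by lra.
apply: (mulIf (lt0r_neq0 pos)).
by transitivity ((a + b) ^+ 2 - 4 * (a * b) + 2 * (a - b)); [|rewrite ab ab0]; ring.
Qed.

Lemma complete2_iso {G : sgraph} : graph_iso G (complete_graph 2) ->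
  #|G| = 2 /\ forall v w : G, adj v w = (v != w).
Proof.
case=> f bij_f adj_f; split; first by rewrite (bij_eq_card bij_f) card_ord.
by move=> v w; rewrite -adj_f /= (inj_eq (bij_inj bij_f)).
Qed.

Theorem theorem16 (R : rcfType) (G : sgraph) :
  (0 < #|G|)%N ->
  no_isolated G ->
  [/\ (2 <= maxdeg G - mindeg G)%N ->
      Num.sqrt (((maxdeg G)%:R - (mindeg G)%:R) ^+ 2
                + 2 * (maxdeg G)%:R + 2 * (mindeg G)%:R) <= spread_Q R G,
      (maxdeg G - mindeg G <= 1)%N ->
      2 * Num.sqrt (maxdeg G)%:R <= spread_Q R G
    & graph_iso G (complete_graph 2) ->
      spread_Q R G = 2 * Num.sqrt (maxdeg G)%:R].
Proof.
move=> G0 _.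
have [c spreadG] := spread_Q_degree R G; have s0 := spread_Q_ge0 (R := R) G0.
have [u du] := maxdeg_attained G0; have [v dv] := mindeg_attained G0.
split=> [_|_|/complete2_iso[G2 adjG]].
- rewrite -[leRHS]ger0_norm // -sqrtr_sqr ler_wsqrtr //.
  have := spreadG u; have := spreadG v; rewrite du dv.
  move: (maxdeg G)%:R (mindeg G)%:R => D d hv hu.
  (* This square is exactly [2 (D - c)^2 + 2 (d - c)^2 - (D - d)^2]. *)
  have := sqr_ge0 (D + d - 2 * c); nra.
- rewrite -[2]ger0_norm // -sqrtr_sqr -sqrtrM ?sqr_ge0 //.
  rewrite -[leRHS]ger0_norm // -sqrtr_sqr ler_wsqrtr //.
  have := spreadG u; rewrite du; have := sqr_ge0 ((maxdeg G)%:R - c); nra.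
have deg1 (w : G) : degree w = 1%N.
  rewrite /degree (_ : [set x | adj w x] = [set~ w]) ?cardsC1 ?G2 //.
  by apply/setP => x; rewrite in_set in_setC1 adjG eq_sym.
rewrite -du deg1 sqrtr1 mulr1.
(* Ones on the diagonal are degrees, ones off it are adjacencies. *)
have QE : signless_laplacian G R = const_mx 1.
  apply/matrixP => i j; rewrite !mxE deg1 adjG (inj_eq enum_val_inj).
  by case: eqP => _; rewrite ?addr0 ?add0r.
by rewrite /spread_Q QE; apply: eigenvals_ones_mx2.
Qed.
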